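(* Let $c>0$, let $\mathcal W\subset\mathbb R_+$ be the wholesale-price menu, and let $M$ be one of the information models, with families $\mathfrak Y_\alpha^M(w)$ of downstream-demand laws, robust expected sales $\underline h_\alpha^M(z,w)=\inf_{\nu\in\mathfrak Y_\alpha^M(w)}\mathbb E_\nu[\min\{z,Y\}]$ and fixed-price value $\Pi_\alpha^M(w)=\max_{z\ge0}\{w\underline h_\alpha^M(z,w)-cz\}$. For fixed $w$, an optimal stock level $z_\alpha^{M,*}(w)$ (a maximizer of $z\mapsto w\underline h_\alpha^M(z,w)-cz$ over $z\ge0$) is given as follows. (i) If $w\le c$, then $z_\alpha^{M,*}(w)=0$. (ii) If $w>c$ and responses are point-valued, then $z_\alpha^{M,*}(w)=q_{\min,\alpha}^M(w)$ and $\Pi_\alpha^M(w)=(w-c)\,q_{\min,\alpha}^M(w)$. (iii) If $w>c$ under tied-price selection ($\alpha=0$), then $z_0^{M,*}(w)\in\arg\max_{0\le z\le\bar b_0^M(w)}\{w\underline h_0^M(z,w)-cz\}$; this objective is concave in $z$, and $\bar b_0^M(w)$ is the largest demand endpoint among the finitely many endpoint cases. The optimal menu policy is $w_\alpha^{M,*}\in\arg\max_{w\in\mathcal W}\Pi_\alpha^M(w)$ with $z_\alpha^{M,*}=z_\alpha^{M,*}(w_\alpha^{M,*})$; that is, it attains $V_\alpha^M=\max_{w\in\mathcal W}\Pi_\alpha^M(w)$.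
   Context: A supplier chooses a wholesale price $w\in\mathcal W$ and stock $z\ge0$ at unit stocking cost $c$; if downstream demand is $q$, profit is $w\min\{z,q\}-cz$. For each information model $M$ and shape parameter $\alpha\in[0,1]$, $\mathfrak Y_\alpha^M(w)$ is a given nonempty set of probability laws of the nonnegative downstream demand $Y$ (market size normalized to one) that may follow $w$. In the paper, $M$ is one of: Q (all $\alpha$-regular demand curves through observed price–demand points), DI (those also making the observed retail prices optimal for the historical wholesale prices), CE and PE (relaxations of DI); the results below use only the following. Responses are point-valued if every law in $\mathfrak Y_\alpha^M(w)$ is a point mass; then $q_{\min,\alpha}^M(w)$ denotes the infimum of the demand levels and $\underline h_\alpha^M(z,w)=\min\{z,q_{\min,\alpha}^M(w)\}$. Tied-price selection ($\alpha=0$): for one demand curve the retailer may have an interval of equally profitable prices and selects uniformly from it. In this case $\underline h_0^M(z,w)$ is the pointwise minimum of finitely many endpoint-case functions $h(z;a_j,b_j)$, where $0<a_j\le b_j$ are the demand endpoints of case $j$ and $h(z;a,b)=z$ for $z\le a$; $h(z;a,b)=\frac{ab}{b-a}\left[\log(z/a)+1-z/b\right]$ for $a<z<b$; $h(z;a,b)=\frac{ab}{b-a}\log(b/a)$ for $z\ge b$; and $h(z;a,a)=\min\{z,a\}$ (a limiting case $a\downarrow0$ has $h\equiv0$). $\bar b_0^M(w)=\max_j b_j$. The maximum over $\mathcal W$ is assumed to be attained (e.g. $\mathcal W$ a finite menu). *)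

(* Defs.v *)
From mathcomp Require Import all_boot all_order all_algebra.
From mathcomp Require Import all_classical all_reals all_analysis.
Set Implicit Arguments.
Unset Strict Implicit.
Unset Printing Implicit Defensive.
Import Order.TTheory GRing.Theory Num.Theory.
Import numFieldNormedType.Exports.
Local Open Scope classical_set_scope.
Local Open Scope ring_scope.

(* Built on MathComp-Analysis, over an arbitrary realType. *)

(* The results are uniform in the information model: the family of laws
   attached to a model is an arbitrary family indexed by these names. *)
Inductive info_model : Set := InfoQ | InfoDI | InfoCE | InfoPE.

Definition law (R : realType) : Type := probability (measurableTypeR R) R.

Section Optimization.
Context {R : realType}.

Definition argmax (T : Type) (A : set T) (f : T -> R) : set T :=
  [set x | A x /\ forall y, A y -> f y <= f x].

Definition is_maximum (A : set R) (v : R) : Prop := A v /\ ubound A v.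

Definition concave_function (D : set R) (f : R -> R) : Prop :=
  convex_function D (fun x => - f x).

Definition nonneg_reals : set R := [set z | 0 <= z].

End Optimization.

Section Newsvendor.
Context {R : realType}.
Implicit Types (nu : law R) (Y : set (law R)).

Definition nonneg_law nu : Prop := nu [set y : R | y < 0] = 0%E.

Definition point_mass nu (q : R) : Prop :=
  forall A : set (measurableTypeR R), measurable A -> nu A = \d_q A.

(* For z >= 0 and nonnegative demand the integrand lies in [0, z], so the
   expectation is finite and [fine] loses nothing; for nonempty Y the set
   below is then nonempty and bounded below by 0. *)
Definition robust_sales Y (z : R) : R :=
  inf [set fine 'E_nu[fun y : R => Num.min z y] | nu in Y].

Definition robust_profit Y (c w z : R) : R := w * robust_sales Y z - c * z.

Definition fixed_price_value Y (c w : R) : R :=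
  sup [set robust_profit Y c w z | z in nonneg_reals].

Definition optimal_stock Y (c w : R) : set R :=
  argmax nonneg_reals (robust_profit Y c w).

Definition point_valued Y : Prop :=
  forall nu, Y nu -> exists q : R, point_mass nu q.

Definition q_min Y : R :=
  inf [set q : R | exists2 nu, Y nu & point_mass nu q].

(* Expected value of min {z, Y} when the retail price p is uniform on an
   interval of equally profitable prices with demand endpoints a <= b: there
   (p - w) Y is constant, so 1/Y is uniform on [1/b, 1/a].  The value a = 0
   encodes the limiting case a -> 0+. *)
Definition endpoint_sales (a b z : R) : R :=
  if a == 0 then 0
  else if a == b then Num.min z a
  else if z <= a then z
  else if z < b then a * b / (b - a) * (ln (z / a) + 1 - z / b)
  else a * b / (b - a) * ln (b / a).

(* Cases are indexed by 'I_n.+1, so that there is at least one and the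
   minimum is seeded by a genuine case. *)
Definition tied_price_selection Y (n : nat) (a b : 'I_n.+1 -> R) : Prop :=
  (forall j, 0 <= a j <= b j) /\
  (forall z : R, 0 <= z ->
     robust_sales Y z =
     \big[Num.min/endpoint_sales (a ord0) (b ord0) z]_(j < n.+1)
        endpoint_sales (a j) (b j) z).

Definition b_bar (n : nat) (b : 'I_n.+1 -> R) : R :=
  \big[Num.max/b ord0]_(j < n.+1) b j.

End Newsvendor.

(* Main.v *)
Require Import Defs.
From mathcomp Require Import all_boot all_order all_algebra.
From mathcomp Require Import all_classical all_reals all_analysis.
From mathcomp Require Import measurable_realfun ring lra.
Set Implicit Arguments.
Unset Strict Implicit.
Unset Printing Implicit Defensive.
Import Order.TTheory GRing.Theory Num.Theory.
Import numFieldNormedType.Exports.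
Local Open Scope classical_set_scope.
Local Open Scope ring_scope.

(* For one nonnegative law, z |-> E[min(z, Y)] is concave, 1-Lipschitz, between
   0 and z, and o(z); the first three properties pass to the infimum over the
   family of laws.  Hence the profit is continuous, concave, vanishes at 0 and,
   when c > 0, is nonpositive for large z, so it attains its maximum.  Point
   masses make it w min(z, q_min) - c z.  Under tied-price selection expected
   sales are constant beyond the largest demand endpoint, where profit thus
   decreases strictly. *)

(** * Expected sales under a single nonnegative law *)

Section ExpectedSales.
Context {R : realType}.
Implicit Types (nu : law R) (Y : set (law R)) (q z : R).

Local Notation D := (`[0, +oo[%classic : set (measurableTypeR R)).

Let measurable_D : measurable D.
Proof. exact: measurable_itv. Qed.

Let measurable_sales (A : set (measurableTypeR R)) z :
  measurable_fun A (fun y : measurableTypeR R => Num.min z y).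
Proof. by apply: measurable_minr => //; exact: measurable_id. Qed.

Lemma nonneg_lawD nu : nonneg_law nu -> nu D = 1%E.
Proof.
move=> nu0.
have -> : D = ~` [set y : measurableTypeR R | y < 0].
  by apply/seteqP; split=> y; rewrite /= in_itv/= andbT leNgt => /negP.
rewrite probability_setC; last first.
  by rewrite -set_itvNyo; exact: measurable_itv.
by rewrite nu0 sube0.
Qed.

(** The negative half-line is null, so dropping it changes nothing. On [D], for [0 <= z], the
    integrand lies in [[0, z]], which makes it integrable and lets pointwise inequalities be
    integrated. *)
Lemma expected_sales_Rintegral nu z : nonneg_law nu ->
  fine 'E_nu[fun y : R => Num.min z y] = \int[nu]_(y in D) Num.min z y.
Proof.
move=> nu0; rewrite unlock /Rintegral [in RHS]integral_mkcond; congr fine.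
apply: ae_eq_integral => //.
- apply/measurable_EFinP; exact: measurable_sales.
- apply/(measurable_restrictT _ _).1 => //.
  apply/measurable_EFinP; exact: measurable_sales.
exists [set y | y < 0]; split => //.
  by rewrite -set_itvNyo; exact: measurable_itv.
move=> y /= h; rewrite ltNge; apply/negP => y0; apply: h => _.
by rewrite patchE ifT// inE /= in_itv/= y0.
Qed.

Let integrable_sales nu z : 0 <= z ->
  nu.-integrable D (EFin \o (fun y => Num.min z y)).
Proof.
move=> z0; apply: measurable_bounded_integrable => //.
  by rewrite (le_lt_trans (probability_le1 _ _)) ?ltry.
exists z; split; first exact: num_real.
move=> M zM y; rewrite /= in_itv/= andbT => y0.
by rewrite ger0_norm ?le_min ?z0// ge_min (ltW zM).
Qed.

Let integrable_cst nu r : nu.-integrable D (EFin \o cst r).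
Proof.
apply: measurable_bounded_integrable => //.
  by rewrite (le_lt_trans (probability_le1 _ _)) ?ltry.
by exists `|r|; split => // M rM y _ /=; exact: ltW.
Qed.

Let integrable_add nu (f g : R -> R) :
  nu.-integrable D (EFin \o f) -> nu.-integrable D (EFin \o g) ->
  nu.-integrable D (EFin \o (fun y => f y + g y)).
Proof. by move=> fi gi; exact: (integrableD measurable_D fi gi). Qed.

Let integrable_scale nu r (f : R -> R) :
  nu.-integrable D (EFin \o f) -> nu.-integrable D (EFin \o (fun y => r * f y)).
Proof. by move=> fi; exact: (integrableZl measurable_D r fi). Qed.

Let Rintegral_law_cst nu r : nonneg_law nu -> \int[nu]_(y in D) (cst r : R -> R) y = r.
Proof. by move=> /nonneg_lawD nuD; rewrite Rintegral_cst// [X in fine X]nuD mulr1. Qed.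

Local Notation E nu z := (fine 'E_nu[fun y : R => Num.min z y]).

Lemma expected_sales_bound nu z : nonneg_law nu -> 0 <= z -> 0 <= E nu z <= z.
Proof.
move=> nu0 z0; rewrite expected_sales_Rintegral//; apply/andP; split.
  apply: Rintegral_ge0 => y; rewrite /= in_itv/= andbT => y0.
  by rewrite le_min z0.
rewrite -[leRHS](Rintegral_law_cst z nu0).
apply: le_Rintegral => //; first exact: integrable_sales.
  exact: integrable_cst.
by move=> y _; rewrite ge_min lexx.
Qed.

Lemma le_expected_sales nu z z' : nonneg_law nu -> 0 <= z -> z <= z' ->
  E nu z <= E nu z' <= E nu z + (z' - z).
Proof.
move=> nu0 z0 zz'; rewrite !expected_sales_Rintegral//.
have z'0 := le_trans z0 zz'; apply/andP; split.
  apply: le_Rintegral => //; [exact: integrable_sales..|].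
  by move=> y _; rewrite le_min !ge_min zz' lexx orbT.
(* Since [D] has mass one, the constant [z' - z] can be moved under the integral and the bound
   checked pointwise. *)
rewrite -[X in _ + X](Rintegral_law_cst (z' - z) nu0) -RintegralD//;
  [|exact: integrable_sales|exact: integrable_cst].
apply: le_Rintegral => //; first exact: integrable_sales.
  apply: integrable_add; [exact: integrable_sales|exact: integrable_cst].
by move=> y _; rewrite /Num.min /=; case: ltP => h1; case: ltP => h2; lra.
Qed.

(** For each [y], [min z y] is a minimum of two affine functions of [z], hence concave; integration
    preserves this. *)
Lemma expected_sales_concave nu t z z' : nonneg_law nu ->
  0 <= t <= 1 -> 0 <= z -> 0 <= z' ->
  t * E nu z + (1 - t) * E nu z' <= E nu (t * z + (1 - t) * z').
Proof.
move=> nu0 /andP[t0 t1] z0 z'0; rewrite !expected_sales_Rintegral//.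
have zz0 : 0 <= t * z + (1 - t) * z' by nra.
rewrite -!RintegralZl//; [|exact: integrable_sales..].
rewrite -RintegralD//; [|exact: integrable_scale (integrable_sales _ _)..].
apply: le_Rintegral => //.
- by apply: integrable_add; exact: integrable_scale (integrable_sales _ _).
- exact: integrable_sales.
move=> y _; rewrite /Num.min.
by case: ltP => h1; case: ltP => h2; case: ltP => h3; nra.
Qed.

(** No finite mean is assumed. Pointwise, [min z y <= n + z * \1_(y > n)], and the tail mass beyond
    [n] is at most [e] for some [n]; [K] is that [n]. *)
Lemma expected_sales_sublinear nu (e : R) : nonneg_law nu -> 0 < e ->
  exists K, forall z, 0 <= z -> E nu z <= K + e * z.
Proof.
move=> nu0 e0.
pose F n : set (measurableTypeR R) := `]n%:R, +oo[%classic.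
have mF n : measurable (F n) by exact: measurable_itv.
have F0 : \bigcap_n F n = set0.
  apply/seteqP; split=> // y /(_ (Num.trunc `|y|).+1 I).
  rewrite /F/= in_itv/= andbT => /lt_trans.
  by move=> /(_ _ (le_lt_trans (ler_norm y) (truncnS_gt _))); rewrite ltxx.
(* Continuity from above along the decreasing tails [F n], whose intersection is empty. *)
have : nu (F n) @[n --> \oo] --> 0%E.
  rewrite -(measure0 nu) -F0; apply: nonincreasing_cvg_mu => //.
  - by rewrite (le_lt_trans (probability_le1 _ _)) ?ltry.
  - by rewrite F0.
  move=> m n mn; apply/subsetPset => y; rewrite /F/= !in_itv/= !andbT.
  by apply: le_lt_trans; rewrite ler_nat.
move=> /fine_cvgP[_] /cvgrPdist_le /(_ _ e0)[n _ /(_ n (leqnn n))]/=.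
rewrite sub0r normrN ger0_norm ?fine_ge0// => Fe.
exists n%:R => z z0; rewrite expected_sales_Rintegral//.
have iF : nu.-integrable D (EFin \o \1_(F n)).
  apply: measurable_bounded_integrable => //.
    by rewrite (le_lt_trans (probability_le1 _ _)) ?ltry.
  exists 1; split=> // M M1 y _ /=; rewrite indicE.
  by case: (_ \in _); rewrite ?normr1 ?normr0 ?(ltW M1)// (le_trans _ (ltW M1)).
have -> : n%:R = \int[nu]_(y in D) (cst n%:R : R -> R) y.
  exact/esym/Rintegral_law_cst.
apply: (@le_trans _ _ (\int[nu]_(y in D) (n%:R + z * \1_(F n) y))).
  apply: le_Rintegral => //; first exact: integrable_sales.
    by apply: integrable_add; [exact: integrable_cst|exact: integrable_scale iF].
  move=> y _; rewrite indicE mem_setE /F in_itv/= andbT.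
  have n0 : 0 <= n%:R :> R by [].
  by case: ltP => h/=; rewrite ge_min ?mulr1 ?mulr0 ?addr0 ?h ?orbT// lerDr n0.
rewrite RintegralD//; [|exact: integrable_cst|exact: integrable_scale iF].
rewrite lerD2l RintegralZl// mulrC ler_wpM2r//.
rewrite /Rintegral integral_indic//; apply: le_trans Fe.
rewrite fine_le ?fin_num_measure//; last exact: measureIl.
exact: measurableI.
Qed.

Lemma expected_sales_point_mass nu q z : point_mass nu q -> E nu z = Num.min z q.
Proof.
move=> nuq; rewrite unlock.
rewrite (@eq_measure_integral _ (measurableTypeR R) _ setT
  \d_(q : measurableTypeR R)); last by move=> A mA _; exact: nuq.
have mmin : measurable_fun [set: measurableTypeR R] (fun y => (Num.min z y)%:E).
  by apply/measurable_EFinP; exact: measurable_sales.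
by rewrite integral_dirac// diracT mul1e.
Qed.

Lemma point_mass_ge0 nu q : nonneg_law nu -> point_mass nu q -> 0 <= q.
Proof.
move=> nu0 nuq; rewrite leNgt; apply/negP => q0.
have := nuq [set y | y < 0]; rewrite nu0 diracE mem_set//.
have m : measurable [set y : measurableTypeR R | y < 0].
  by rewrite -set_itvNyo; exact: measurable_itv.
by move=> /(_ m) /eqP; rewrite eq_sym onee_eq0.
Qed.

End ExpectedSales.

(** * Robust sales and profit over a family of laws *)

Section Robust.
Context {R : realType}.
Implicit Types (c w x z q : R).
Variable Y : set (law R).
Hypothesis Y_neq0 : Y !=set0.
Hypothesis Y_nonneg : forall nu, Y nu -> nonneg_law nu.

Lemma robust_sales_le nu z : Y nu -> 0 <= z ->
  robust_sales Y z <= fine 'E_nu[fun y : R => Num.min z y].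
Proof.
move=> Ynu z0; apply: ge_inf; last by exists nu.
exists 0 => _ [nu' Ynu' <-].
by have /andP[] := expected_sales_bound (Y_nonneg Ynu') z0.
Qed.

Lemma le_robust_sales x z :
  (forall nu, Y nu -> x <= fine 'E_nu[fun y : R => Num.min z y]) ->
  x <= robust_sales Y z.
Proof.
move=> xE; apply: lb_le_inf; last by move=> _ [nu Ynu <-]; exact: xE.
by have [nu Ynu] := Y_neq0; exists (fine 'E_nu[fun y : R => Num.min z y]), nu.
Qed.

Lemma robust_sales_bound z : 0 <= z -> 0 <= robust_sales Y z <= z.
Proof.
move=> z0; apply/andP; split.
  apply: le_robust_sales => nu Ynu.
  by have /andP[] := expected_sales_bound (Y_nonneg Ynu) z0.
have [nu Ynu] := Y_neq0; apply: le_trans (robust_sales_le Ynu z0) _.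
by have /andP[] := expected_sales_bound (Y_nonneg Ynu) z0.
Qed.

Lemma robust_sales_lipschitz z z' : 0 <= z -> z <= z' ->
  robust_sales Y z <= robust_sales Y z' <= robust_sales Y z + (z' - z).
Proof.
move=> z0 zz'; apply/andP; split.
  apply: le_robust_sales => nu Ynu; apply: le_trans (robust_sales_le Ynu z0) _.
  by have /andP[] := le_expected_sales (Y_nonneg Ynu) z0 zz'.
rewrite -lerBlDr; apply: le_robust_sales => nu Ynu; rewrite lerBlDr.
apply: le_trans (robust_sales_le Ynu (le_trans z0 zz')) _.
by have /andP[] := le_expected_sales (Y_nonneg Ynu) z0 zz'.
Qed.

(** An infimum of concave functions is concave: under each law, the combination of expectations
    dominates that of the infima. *)
Lemma robust_sales_concave t z z' : 0 <= t <= 1 -> 0 <= z -> 0 <= z' ->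
  t * robust_sales Y z + (1 - t) * robust_sales Y z' <=
  robust_sales Y (t * z + (1 - t) * z').
Proof.
move=> t01 z0 z'0; apply: le_robust_sales => nu Ynu.
apply: le_trans (expected_sales_concave (Y_nonneg Ynu) t01 z0 z'0).
have /andP[t0 t1] := t01.
by rewrite lerD// ler_wpM2l ?subr_ge0//; exact: robust_sales_le.
Qed.

Lemma robust_profit_concave c w : 0 <= w ->
  concave_function nonneg_reals (robust_profit Y c w).
Proof.
move=> w0 t x y; rewrite !inE /nonneg_reals/= => x0 y0.
have t01 : 0 <= (t%:num : R) <= 1 by rewrite ge0 le1.
have H := ler_wpM2l w0 (robust_sales_concave t01 x0 y0).
(* The convex combination in plain ring operations, convertible to the abstract one, so that [lra]
   applies. *)
pose u : R := t%:num * x + (1 - t%:num) * y.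
suff : - robust_profit Y c w u <=
  t%:num * - robust_profit Y c w x + (1 - t%:num) * - robust_profit Y c w y by [].
by rewrite /robust_profit; move: H; rewrite -/u /u; lra.
Qed.

Lemma robust_profit0 c w : robust_profit Y c w 0 = 0.
Proof.
have := robust_sales_bound (lexx 0); rewrite -eq_le => /eqP h0.
by rewrite /robust_profit -h0 !mulr0 subr0.
Qed.

(** Sales never exceed stock, so profit is at most [(w - c) * z <= 0], its value at zero stock. *)
Lemma optimal_stock_low_price c w : 0 <= w <= c -> optimal_stock Y c w 0.
Proof.
move=> /andP[w0 wc]; split; first exact: lexx.
move=> z; rewrite /nonneg_reals/= => z0; rewrite robust_profit0 /robust_profit.
have /andP[h0 hz] := robust_sales_bound z0; nra.
Qed.

(** Clamping by [Num.max 0] extends profit from the half-line to all of [R]. The extension is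
    Lipschitz with constant [w + c], because clamping is nonexpansive and sales are 1-Lipschitz. *)
Lemma robust_profit_continuous c w : 0 <= c -> 0 <= w ->
  continuous (fun z : R => robust_profit Y c w (Num.max 0 z)).
Proof.
move=> c0 w0.
have lip x y : x <= y -> `|robust_profit Y c w (Num.max 0 x) -
    robust_profit Y c w (Num.max 0 y)| <= (w + c) * (y - x).
  move=> xy; have x0 : 0 <= Num.max 0 x by rewrite le_max lexx.
  have mxy : Num.max 0 x <= Num.max 0 y.
    by rewrite ge_max !le_max lexx xy !orbT.
  have mB : Num.max 0 y - Num.max 0 x <= y - x.
    by rewrite /Num.max; case: ltP => ?; case: ltP => ?; lra.
  have := robust_sales_lipschitz x0 mxy; move: mxy mB x0.
  rewrite /robust_profit; set X := Num.max 0 x; set X' := Num.max 0 y.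
  by move=> ? ? ? /andP[? ?]; rewrite ler_norml; apply/andP; split; nra.
move=> x; apply/cvgrPdist_le => e e0; near=> y.
(* The extra 1 keeps the divisor positive even when [w + c = 0]. *)
apply: (@le_trans _ _ ((w + c + 1) * `|x - y|)).
  have [xy|yx] := leP x y.
    by rewrite distrC (distrC x) (ger0_norm (_ : 0 <= y - x)) ?subr_ge0// distrC;
      have := lip _ _ xy; nra.
  by rewrite distrC (ger0_norm (_ : 0 <= x - y)) ?subr_ge0 ?(ltW yx)//;
      have := lip _ _ (ltW yx); nra.
rewrite -ler_pdivlMl; last lra.
near: y; apply: cvgr_dist_le; first exact: cvg_id.
by rewrite mulr_gt0// invr_gt0; lra.
Unshelve. all: by end_near. Qed.

Lemma optimal_stock_neq0 c w : 0 < c -> 0 <= w -> optimal_stock Y c w !=set0.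
Proof.
move=> c0; rewrite le_eqVlt => /predU1P[<-|w0].
  by exists 0; apply: optimal_stock_low_price; rewrite lexx ltW.
have [nu Ynu] := Y_neq0.
(* With this slope, revenue is at most [w * K + c * z / 2], so half of the stocking cost is left
   over and profit is nonpositive once [z >= 2 * w * K / c]. *)
have e0 : 0 < c / (2 * w) by rewrite divr_gt0// mulr_gt0.
have [K HK] := expected_sales_sublinear (Y_nonneg Ynu) e0.
pose B := Num.max 0 (2 * w * K / c).
have B0 : 0 <= B by rewrite le_max lexx.
have [|z0 z0B z0max] := @EVT_max _ (fun z : R => robust_profit Y c w (Num.max 0 z)) _ _ B0.
  by apply: continuous_subspaceT; apply: robust_profit_continuous; exact: ltW.
move: z0B; rewrite in_itv/= => /andP[z0ge0 z0B].
exists z0; split=> // z; rewrite /nonneg_reals/= => zge0.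
have [zB|Bz] := leP z B.
  by have := z0max z; rewrite in_itv/= zge0 zB !max_r//; exact.
(* The maximizer on [[0, B]] does at least as well as zero stock, so beyond [B] a nonpositive profit
   suffices. *)
have := z0max 0; rewrite in_itv/= lexx B0 maxxx (max_r z0ge0) robust_profit0.
move=> /(_ isT); apply: le_trans.
have hz : robust_sales Y z <= K + c / (2 * w) * z.
  exact: le_trans (robust_sales_le Ynu zge0) (HK _ zge0).
have Kz : 2 * w * K <= c * z.
  rewrite (mulrC c) -ler_pdivrMr//.
  by apply: le_trans (ltW Bz); rewrite le_max lexx orbT.
rewrite /robust_profit.
have := ler_wpM2l (ltW w0) hz.
have -> : w * (K + c / (2 * w) * z) = w * K + c * z / 2.
  by field; rewrite gt_eqF.
lra.
Qed.

Lemma q_min_le nu q : Y nu -> point_mass nu q -> q_min Y <= q.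
Proof.
move=> Ynu nuq; apply: ge_inf; last by exists nu.
by exists 0 => r [nu' /Y_nonneg nu'0]; exact: point_mass_ge0.
Qed.

Lemma q_min_ge0 : point_valued Y -> 0 <= q_min Y.
Proof.
move=> pY; have [nu Ynu] := Y_neq0; have [q nuq] := pY _ Ynu.
apply: lb_le_inf; first by exists q, nu.
by move=> r [nu' /Y_nonneg nu'0]; exact: point_mass_ge0.
Qed.

(** Taking the minimum with [z] commutes with the infimum over demand levels. *)
Lemma robust_sales_point_valued z : point_valued Y -> 0 <= z ->
  robust_sales Y z = Num.min z (q_min Y).
Proof.
move=> pY z0; apply/eqP; rewrite eq_le; apply/andP; split.
  rewrite le_min; have /andP[_ ->] := robust_sales_bound z0.
  have [nu Ynu] := Y_neq0; have [q nuq] := pY _ Ynu.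
  apply: lb_le_inf; first by exists q, nu.
  move=> r [nu' Ynu' nu'r]; apply: le_trans (robust_sales_le Ynu' z0) _.
  by rewrite (expected_sales_point_mass _ nu'r) ge_min lexx orbT.
apply: le_robust_sales => nu Ynu; have [q nuq] := pY _ Ynu.
rewrite (expected_sales_point_mass _ nuq).
by rewrite le_min !ge_min lexx (q_min_le Ynu nuq) orbT.
Qed.

Lemma robust_profit_q_min c w : point_valued Y ->
  robust_profit Y c w (q_min Y) = (w - c) * q_min Y.
Proof.
move=> pY; rewrite /robust_profit robust_sales_point_valued// ?q_min_ge0//.
by rewrite minxx mulrBl.
Qed.

(** Profit has slope [w - c > 0] up to [q_min Y] and slope [- c] afterwards. *)
Lemma optimal_stock_q_min c w : 0 <= c -> c < w -> point_valued Y ->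
  optimal_stock Y c w (q_min Y).
Proof.
move=> c0 cw pY; split; first exact: q_min_ge0.
move=> z; rewrite /nonneg_reals/= => z0; rewrite robust_profit_q_min//.
rewrite /robust_profit robust_sales_point_valued//.
by rewrite /Num.min; case: ltP => h; nra.
Qed.

End Robust.

(** * Endpoint cases, and general facts on [argmax] and [sup] *)

Section Endpoint.
Context {R : realType}.

Lemma endpoint_sales_const (a b z : R) : 0 <= a <= b -> b <= z ->
  endpoint_sales a b z = endpoint_sales a b b.
Proof.
move=> /andP[a0 ab] bz; rewrite /endpoint_sales; case: eqVneq => // _.
case: eqVneq => [->|aneqb]; first by rewrite minxx min_r.
have ltab : a < b by rewrite lt_neqAle aneqb.
by rewrite !leNgt ltab (lt_le_trans ltab bz)/= ltxx ltNge bz.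
Qed.

Lemma b_bar_ge n (b : 'I_n.+1 -> R) j : b j <= b_bar b.
Proof. exact: le_bigmax. Qed.

Lemma b_bar_attained n (b : 'I_n.+1 -> R) : exists j, b j = b_bar b.
Proof.
rewrite /b_bar; apply: (big_ind (fun x => exists j, b j = x)).
- by exists ord0.
- by move=> x y hx hy; rewrite /Num.max; case: ifP.
- by move=> j _; exists j.
Qed.

Lemma robust_sales_const Y n (a b : 'I_n.+1 -> R) z :
  tied_price_selection Y a b -> b_bar b <= z ->
  robust_sales Y z = robust_sales Y (b_bar b).
Proof.
move=> [ab rs] bz.
have bb0 : 0 <= b_bar b.
  by have /andP[h1 h2] := ab ord0; exact: le_trans (le_trans h1 h2) (b_bar_ge _ _).
rewrite !rs ?(le_trans bb0)//.
(* Every case is on its plateau at both points. The seed of the minimum is itself a case, hence the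
   rewrite by [H] before [eq_bigr]. *)
have H j : endpoint_sales (a j) (b j) z = endpoint_sales (a j) (b j) (b_bar b).
  by rewrite !endpoint_sales_const// ?(le_trans (b_bar_ge _ _) bz)// b_bar_ge.
by rewrite H; apply: eq_bigr => j _.
Qed.

(** Cutting stock back to [b_bar b] loses no sales and saves a positive cost. *)
Lemma optimal_stock_le_b_bar Y c w n (a b : 'I_n.+1 -> R) z : 0 < c ->
  tied_price_selection Y a b -> optimal_stock Y c w z -> z <= b_bar b.
Proof.
move=> c0 tY [_ zmax]; rewrite leNgt; apply/negP => bz.
have bb0 : 0 <= b_bar b.
  by have /andP[h1 h2] := tY.1 ord0; exact: le_trans (le_trans h1 h2) (b_bar_ge _ _).
have := zmax _ bb0; rewrite /robust_profit (robust_sales_const tY (ltW bz)).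
by rewrite lerD2l lerN2 ler_pM2l// leNgt bz.
Qed.

(** A maximizer over [A] lies in [B], so a maximizer over [B] matches its value and is therefore
    maximal over [A]. Nonemptiness provides this point of comparison. *)
Lemma argmax_subset (T : Type) (A B : set T) (f : T -> R) :
  B `<=` A -> argmax A f !=set0 -> argmax A f `<=` B -> argmax A f = argmax B f.
Proof.
move=> BA [x0 mx0] AB; apply/seteqP; split=> x [Ax xmax].
  by split=> [|y /BA]; [exact: AB|exact: xmax].
by split=> [|y Ay]; [exact: BA|exact: le_trans (mx0.2 _ Ay) (xmax _ (AB _ mx0))].
Qed.

Lemma argmax_is_maximum (T : Type) (A : set T) (f : T -> R) x :
  argmax A f x -> is_maximum [set f y | y in A] (f x).
Proof. by move=> [Ax xmax]; split; [exists x|move=> _ [y Ay <-]; exact: xmax]. Qed.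

Lemma is_maximum_sup (A : set R) v : is_maximum A v -> sup A = v.
Proof.
move=> [Av ubv]; apply/eqP; rewrite eq_le ge_sup//; last by exists v.
by rewrite ub_le_sup//; exists v.
Qed.

(** Attainment turns the [sup] in [fixed_price_value] and in the menu value into a genuine maximum
    rather than a default value. *)
Lemma argmax_sup (T : Type) (A : set T) (f : T -> R) x :
  argmax A f x -> sup [set f y | y in A] = f x.
Proof. by move=> mx; exact: is_maximum_sup (argmax_is_maximum mx). Qed.

End Endpoint.

Theorem theorem4 (R : realType) (c : R) (W : set R)
    (laws : info_model -> R -> R -> set (law R))
    (M : info_model) (alpha : R)
    (hc : 0 < c) (hW : W `<=` nonneg_reals)
    (halpha : 0 <= alpha <= 1)
    (hne : forall w, W w -> laws M alpha w !=set0)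
    (hnonneg : forall w, W w -> forall nu, laws M alpha w nu -> nonneg_law nu)
    (hattained :
      argmax W (fun w => fixed_price_value (laws M alpha w) c w) !=set0) :
  let Y := laws M alpha in
  let Pi := fun w => fixed_price_value (Y w) c w in
  let V := sup [set Pi w | w in W] in
  (forall w, W w ->
     is_maximum [set robust_profit (Y w) c w z | z in nonneg_reals] (Pi w)) /\
  (forall w, W w -> w <= c -> optimal_stock (Y w) c w 0) /\
  (forall w, W w -> c < w -> point_valued (Y w) ->
     optimal_stock (Y w) c w (q_min (Y w)) /\
     Pi w = (w - c) * q_min (Y w)) /\
  (forall w, W w -> c < w -> alpha = 0 ->
     forall (n : nat) (a b : 'I_n.+1 -> R), tied_price_selection (Y w) a b ->
       let restricted_stock :=
         argmax [set z | 0 <= z <= b_bar b] (robust_profit (Y w) c w) in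
       [/\ restricted_stock !=set0,
           optimal_stock (Y w) c w = restricted_stock,
           concave_function nonneg_reals (robust_profit (Y w) c w) &
           (exists j, b j = b_bar b) /\
           (forall j, a j <= b_bar b /\ b j <= b_bar b)]) /\
  (is_maximum [set Pi w | w in W] V /\
   forall w_opt z_opt : R,
     argmax W Pi w_opt -> optimal_stock (Y w_opt) c w_opt z_opt ->
     robust_profit (Y w_opt) c w_opt z_opt = V).
Proof.
move=> Y Pi V.
have opt w : W w -> optimal_stock (Y w) c w !=set0.
  by move=> Ww; apply: optimal_stock_neq0 => //; [exact: hne|exact: hnonneg|exact: hW].
have PiE w z : optimal_stock (Y w) c w z -> Pi w = robust_profit (Y w) c w z.
  by move=> oz; exact: argmax_sup oz.
split.
  move=> w Ww; have [z oz] := opt w Ww.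
  by rewrite (PiE _ _ oz); exact: argmax_is_maximum.
split.
  move=> w Ww wc; apply: optimal_stock_low_price; [exact: hne|exact: hnonneg|].
  by rewrite wc andbT; exact: hW.
split.
  move=> w Ww cw pY.
  have oq : optimal_stock (Y w) c w (q_min (Y w)).
    by apply: optimal_stock_q_min => //; [exact: hne|exact: hnonneg|exact: ltW].
  split=> //; rewrite (PiE _ _ oq); apply: robust_profit_q_min => //.
    exact: hne.
  exact: hnonneg.
split.
  move=> w Ww cw _ n a b tY restricted_stock.
  (* Unrestricted optima exist and all lie in [[0, b_bar b]], so restricting the stock range changes
     nothing. *)
  have optE : optimal_stock (Y w) c w = restricted_stock.
    apply: argmax_subset; [by move=> z /= /andP[]|exact: opt|move=> z oz /=].
    by rewrite (optimal_stock_le_b_bar hc tY oz) andbT; exact: oz.1.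
  split=> //; first by rewrite -optE; exact: opt.
    by apply: robust_profit_concave; [exact: hne|exact: hnonneg|exact: hW].
  split; first exact: b_bar_attained.
  move=> j; split; last exact: b_bar_ge.
  by have /andP[_ ajbj] := tY.1 j; exact: le_trans ajbj (b_bar_ge _ _).
have VE w : argmax W Pi w -> V = Pi w by exact: argmax_sup.
have [w1 mw1] := hattained.
split; first by rewrite (VE _ mw1); exact: argmax_is_maximum.
by move=> w z mw oz; rewrite (VE _ mw) (PiE _ _ oz).
Qed.
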